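(* Let $A$ be an affine graded algebra generated in degree $1$, of finite Gelfand-Kirillov dimension, over an algebraically closed field $\Bbbk$ of characteristic zero. Let $G$ be a finite group acting on $A$ by graded algebra automorphisms and let $H\le G$ be a subgroup. Then $\mathsf p(A,G)\le \mathsf p(A,H)$.
   Context: The skew group algebra $A\#G$ is $A\otimes \Bbbk G$ as a vector space with multiplication $(a\# g)(b\# h)=a\,g(b)\# gh$. Put $f_G=\sum_{g\in G}1\#g\in A\#G$ and let $(f_G)$ be the two-sided ideal of $A\#G$ it generates. The pertinency of the $G$-action on $A$ is $\mathsf p(A,G)=\operatorname{GKdim}A-\operatorname{GKdim}\,(A\#G)/(f_G)$, where $\operatorname{GKdim}$ is Gelfand-Kirillov dimension; $\mathsf p(A,H)$ is defined in the same way for the restricted action of $H$, using $A\#H$ and $f_H$. *)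

(* Defs.v *)
From HB Require Import structures.
From mathcomp Require Import all_boot all_order all_algebra all_fingroup.
From mathcomp Require Import generic_quotient ring_quotient.
From mathcomp Require Import all_classical all_reals all_analysis.

Set Implicit Arguments.
Unset Strict Implicit.
Unset Printing Implicit Defensive.
Import Order.TTheory GRing.Theory Num.Theory.
Local Open Scope classical_set_scope.
Local Open Scope ring_scope.

(* MathComp's algType requires 1 != 0, but B/(f) may be the zero ring, so
   Gelfand-Kirillov dimension is defined for possibly zero algebras. *)
Record pzAlg (k : pzRingType) := PzAlg {
  pz_mod :> lmodType k;
  pz_one : pz_mod;
  pz_mul : pz_mod -> pz_mod -> pz_mod;
  pz_mulA : associative pz_mul;
  pz_mul1r : left_id pz_one pz_mul;
  pz_mulr1 : right_id pz_one pz_mul;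
  pz_mulDl : left_distributive pz_mul +%R;
  pz_mulDr : right_distributive pz_mul +%R;
  pz_scalerAl : forall (c : k) x y, c *: pz_mul x y = pz_mul (c *: x) y;
  pz_scalerAr : forall (c : k) x y, c *: pz_mul x y = pz_mul x (c *: y)
}.

Definition pz_of_alg (k : pzRingType) (A : algType k) : pzAlg k :=
  @PzAlg k A 1 *%R (@mulrA A) (@mul1r A) (@mulr1 A) (@mulrDl A) (@mulrDr A)
    (@scalerAl k A) (@scalerAr k A).
Coercion pz_of_alg : GRing.Algebra.type >-> pzAlg.

Section LinearDimension.
Variables (k : pzRingType) (V : lmodType k).

Definition lspan (X : set V) : set V :=
  [set v | exists2 s : seq (k * V), (forall p, p \in s -> X p.2)
                                  & v = \sum_(p <- s) p.1 *: p.2].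

Definition lin_indep n (t : 'I_n -> V) : Prop :=
  forall c : 'I_n -> k, \sum_i c i *: t i = 0 -> forall i, c i = 0.

Definition ldim (R : realType) (U : set V) : \bar R :=
  ereal_sup [set n%:R%:E | n in
    [set n : nat | exists2 t : 'I_n -> V, (forall i, U (t i)) & lin_indep t]].

End LinearDimension.

Section GelfandKirillov.
Variables (R : realType) (k : pzRingType) (B : pzAlg k).

Definition words (X : set B) : set (seq B) := [set w | forall y, y \in w -> X y].

Definition word_prod (w : seq B) : B := foldr (@pz_mul k B) (pz_one B) w.

Definition generates (X : set B) : Prop :=
  lspan [set word_prod w | w in words X] = [set: B].

Definition affine : Prop := exists s : seq B, generates [set` s].

(* With V the span of s, this is V^0 + V^1 + ... + V^n. *)
Definition gk_filtration (s : seq B) (n : nat) : set B :=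
  lspan [set word_prod w | w in
    [set w | words [set` s] w /\ (size w <= n)%N]].

(* The supremum over finite-dimensional subspaces V of
   limsup_n log_n dim (V^0 + ... + V^n). Since lne 0 = -oo, the zero algebra
   has dimension -oo. *)
Definition gkdim : \bar R :=
  ereal_sup [set limn_esup (fun n : nat =>
      (lne (ldim R (gk_filtration s n)) * ((ln n%:R)^-1)%:E)%E)
    | s in [set: seq B]].

End GelfandKirillov.

Arguments generates {k} B X.
Arguments affine {k} B.
Arguments gkdim R {k} B.

Section Grading.
Variables (k : pzRingType) (A : algType k).

Record is_grading (gr : nat -> set A) : Prop := IsGrading {
  grading0 : forall n, gr n 0;
  gradingP : forall n (c : k) x y, gr n x -> gr n y -> gr n (c *: x + y);
  grading1 : gr 0%N 1;
  gradingM : forall m n x y, gr m x -> gr n y -> gr (m + n)%N (x * y);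
  grading_span : forall x, exists n (c : nat -> A),
    (forall i, gr i (c i)) /\ x = \sum_(i < n) c i;
  grading_direct : forall n (c : nat -> A), (forall i, gr i (c i)) ->
    \sum_(i < n) c i = 0 -> forall i : nat, (i < n)%N -> c i = 0
}.

End Grading.

Record algAction (k : pzRingType) (gT : finGroupType) (A : algType k) :=
  AlgAction {
    alg_act :> gT -> {lrmorphism A -> A};
    alg_act1 : forall x, alg_act 1%g x = x;
    alg_actM : forall g h x, alg_act (g * h)%g x = alg_act g (alg_act h x)
  }.

Section Restriction.
Variables (k : pzRingType) (gT : finGroupType) (A : algType k).
Variables (rho : algAction gT A) (H : {group gT}).

Fact res_act1 x : rho (sgval (1%g : [subg H])) x = x.
Proof. exact: alg_act1. Qed.

Fact res_actM (g h : [subg H]) x :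
  rho (sgval (g * h)%g) x = rho (sgval g) (rho (sgval h) x).
Proof. exact: alg_actM. Qed.

Definition res_action : algAction [subg H] A :=
  @AlgAction k [subg H] A (fun h => rho (sgval h)) res_act1 res_actM.

End Restriction.

(* u : skew rho stands for \sum_g u g # g in A # G. *)
Definition skew (k : pzRingType) (gT : finGroupType) (A : algType k)
  (rho : algAction gT A) : Type := {ffun gT -> A}.

Section SkewGroupAlgebra.
Variables (k : pzRingType) (gT : finGroupType) (A : algType k).
Variable rho : algAction gT A.
Local Notation S := (skew rho).

HB.instance Definition _ := GRing.Lmodule.copy S {ffun gT -> A}.

Definition skew_elt (a : A) (g : gT) : S := [ffun x => if x == g then a else 0].
Definition skew_one : S := skew_elt 1 1%g.

(* Collects (a # g)(b # h) = a g(b) # gh with gh = x. *)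
Definition skew_mul (u v : S) : S :=
  [ffun x => \sum_g u g * rho g (v (g^-1 * x)%g)].

Fact skew_mulA : associative skew_mul.
Proof.
move=> u v w; apply/ffunP => x; rewrite !ffunE.
under eq_bigr => g _ do rewrite ffunE raddf_sum mulr_sumr.
under [RHS]eq_bigr => h _ do rewrite ffunE mulr_suml.
rewrite [RHS]exchange_big /=; apply: eq_bigr => g _.
rewrite [RHS](reindex_inj (mulgI g)) /=; apply: eq_bigr => h _.
by rewrite rmorphM /= mulrA -alg_actM mulKg invMg mulgA.
Qed.

Fact skew_mul1 : left_id skew_one skew_mul.
Proof.
move=> u; apply/ffunP => x; rewrite ffunE (bigD1 1%g) //= big1 => [|g ng].
  by rewrite ffunE eqxx mul1r alg_act1 invg1 mul1g addr0.
by rewrite ffunE (negPf ng) mul0r.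
Qed.

Fact skew_mulr1 : right_id skew_one skew_mul.
Proof.
move=> u; apply/ffunP => x; rewrite ffunE (bigD1 x) //= big1 => [|g ng].
  by rewrite ffunE mulVg eqxx rmorph1 mulr1 addr0.
rewrite ffunE; case: eqP => [e|_]; last by rewrite raddf0 mulr0.
by rewrite (_ : g = x) ?eqxx // in ng; rewrite -[x](mulKVg g) e mulg1.
Qed.

Fact skew_mulDl : left_distributive skew_mul +%R.
Proof.
move=> u v w; apply/ffunP => x; rewrite !ffunE -big_split /=.
by apply: eq_bigr => g _; rewrite ffunE mulrDl.
Qed.

Fact skew_mulDr : right_distributive skew_mul +%R.
Proof.
move=> u v w; apply/ffunP => x; rewrite !ffunE -big_split /=.
by apply: eq_bigr => g _; rewrite ffunE raddfD mulrDr.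
Qed.

Fact skew_oner_neq0 : skew_one != 0.
Proof.
by apply/eqP => /ffunP /(_ 1%g); rewrite !ffunE eqxx; apply/eqP/oner_neq0.
Qed.

HB.instance Definition _ := GRing.Zmodule_isNzRing.Build S
  skew_mulA skew_mul1 skew_mulr1 skew_mulDl skew_mulDr skew_oner_neq0.

Fact skew_scalerAl (c : k) (u v : S) : c *: (u * v) = (c *: u) * v.
Proof.
apply/ffunP => x; rewrite !ffunE scaler_sumr.
by apply: eq_bigr => g _; rewrite ffunE scalerAl.
Qed.

HB.instance Definition _ := GRing.Lmodule_isLalgebra.Build k S skew_scalerAl.

Fact skew_scalerAr (c : k) (u v : S) : c *: (u * v) = u * (c *: v).
Proof.
apply/ffunP => x; rewrite !ffunE scaler_sumr.
by apply: eq_bigr => g _; rewrite ffunE linearZ /= scalerAr.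
Qed.

HB.instance Definition _ := GRing.Lalgebra_isAlgebra.Build k S skew_scalerAr.

Lemma skew_eltM a g b h :
  skew_elt a g * skew_elt b h = skew_elt (a * rho g b) (g * h)%g :> S.
Proof.
apply/ffunP => x; rewrite !ffunE (bigD1 g) //= big1 => [|i ni]; last first.
  by rewrite ffunE (negPf ni) mul0r.
rewrite !ffunE eqxx addr0 -(inj_eq (mulgI g)) mulKVg.
by case: eqP => // _; rewrite raddf0 mulr0.
Qed.

Definition skew_sum : S := \sum_(g : gT) skew_elt 1 g.

End SkewGroupAlgebra.

Section PrincipalQuotient.
Variables (k : pzRingType) (B : algType k) (f : B).

Definition ideal_gen : {pred B} := fun x =>
  `[< exists s : seq (B * B), x = \sum_(p <- s) p.1 * f * p.2 >].

Fact ideal_gen_zmod_closed : zmod_closed ideal_gen.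
Proof.
split=> [|x y /asboolP[s ->] /asboolP[t ->]]; apply/asboolP.
  by exists [::]; rewrite big_nil.
exists (s ++ [seq (- p.1, p.2) | p <- t]).
rewrite big_cat big_map /= -sumrN; congr (_ + _).
by apply: eq_bigr => p _; rewrite !mulNr.
Qed.

HB.instance Definition _ :=
  GRing.isZmodClosed.Build B ideal_gen ideal_gen_zmod_closed.

Fact ideal_genMl a x : x \in ideal_gen -> a * x \in ideal_gen.
Proof.
move=> /asboolP[s ->]; apply/asboolP; exists [seq (a * p.1, p.2) | p <- s].
by rewrite big_map mulr_sumr; apply: eq_bigr => p _; rewrite !mulrA.
Qed.

Fact ideal_genMr a x : x \in ideal_gen -> x * a \in ideal_gen.
Proof.
move=> /asboolP[s ->]; apply/asboolP; exists [seq (p.1, p.2 * a) | p <- s].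
by rewrite big_map mulr_suml; apply: eq_bigr => p _; rewrite !mulrA.
Qed.

Fact ideal_genZ (c : k) x : x \in ideal_gen -> c *: x \in ideal_gen.
Proof. by move=> /(ideal_genMl (c *: 1)); rewrite -scalerAl mul1r. Qed.

Local Open Scope quotient_scope.

Definition quot_type : Type := {ideal_quot ideal_gen}.

HB.instance Definition _ := GRing.Zmodule.on quot_type.

Local Notation Q := quot_type.
Local Notation pi := (\pi_{ideal_quot ideal_gen} : B -> Q).

Definition quot_one : Q := pi 1.
Definition quot_mul (x y : Q) : Q := pi (repr x * repr y).
Definition quot_scale (c : k) (x : Q) : Q := pi (c *: repr x).

Let piE x y : (pi x = pi y) <-> (x - y \in ideal_gen).
Proof. by rewrite (Quotient.idealrBE ideal_gen); split=> /eqP. Qed.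

Let piK (x : Q) : pi (repr x) = x. Proof. exact: reprK. Qed.

Let piD x y : pi (x + y) = pi x + pi y. Proof. exact: raddfD. Qed.

Fact quot_mulE x y : quot_mul (pi x) (pi y) = pi (x * y).
Proof.
apply/piE; set x' := repr _; set y' := repr _.
have hx : x' - x \in ideal_gen by apply/piE; rewrite piK.
have hy : y' - y \in ideal_gen by apply/piE; rewrite piK.
rewrite (_ : _ - _ = (x' - x) * y' + x * (y' - y)).
  by apply: rpredD; [apply: ideal_genMr | apply: ideal_genMl].
by rewrite mulrBl mulrBr addrA subrK.
Qed.

Fact quot_scaleE c x : quot_scale c (pi x) = pi (c *: x).
Proof. by apply/piE; rewrite -scalerBr ideal_genZ //; apply/piE; rewrite piK. Qed.

Let quot_ind (P : Q -> Prop) : (forall x, P (pi x)) -> forall x, P x.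
Proof. by move=> h x; rewrite -[x]piK. Qed.

Fact quot_mulA : associative quot_mul.
Proof.
elim/quot_ind=> x; elim/quot_ind=> y; elim/quot_ind=> z.
by rewrite !quot_mulE mulrA.
Qed.

Fact quot_mul1 : left_id quot_one quot_mul.
Proof. by elim/quot_ind=> x; rewrite quot_mulE mul1r. Qed.

Fact quot_mulr1 : right_id quot_one quot_mul.
Proof. by elim/quot_ind=> x; rewrite quot_mulE mulr1. Qed.

Fact quot_mulDl : left_distributive quot_mul +%R.
Proof.
elim/quot_ind=> x; elim/quot_ind=> y; elim/quot_ind=> z.
by rewrite -piD !quot_mulE mulrDl piD.
Qed.

Fact quot_mulDr : right_distributive quot_mul +%R.
Proof.
elim/quot_ind=> x; elim/quot_ind=> y; elim/quot_ind=> z.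
by rewrite -piD !quot_mulE mulrDr piD.
Qed.

Fact quot_scalerA a b x : quot_scale a (quot_scale b x) = quot_scale (a * b) x.
Proof. by elim/quot_ind: x => x; rewrite !quot_scaleE scalerA. Qed.

Fact quot_scale1r : left_id 1 quot_scale.
Proof. by elim/quot_ind=> x; rewrite quot_scaleE scale1r. Qed.

Fact quot_scalerDr : right_distributive quot_scale +%R.
Proof.
move=> c; elim/quot_ind=> x; elim/quot_ind=> y.
by rewrite -piD !quot_scaleE scalerDr piD.
Qed.

Fact quot_scalerDl x : {morph quot_scale^~ x : a b / a + b}.
Proof. by move=> a b; elim/quot_ind: x => x; rewrite !quot_scaleE scalerDl piD. Qed.

HB.instance Definition _ := GRing.Zmodule_isLmodule.Build k Q
  quot_scalerA quot_scale1r quot_scalerDr quot_scalerDl.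

Let scaleqE (c : k) x : c *: (pi x : Q) = pi (c *: x).
Proof. exact: quot_scaleE. Qed.

Fact quot_scalerAl (c : k) (x y : Q) : c *: quot_mul x y = quot_mul (c *: x) y.
Proof.
elim/quot_ind: x => x; elim/quot_ind: y => y.
by rewrite quot_mulE !scaleqE quot_mulE scalerAl.
Qed.

Fact quot_scalerAr (c : k) (x y : Q) : c *: quot_mul x y = quot_mul x (c *: y).
Proof.
elim/quot_ind: x => x; elim/quot_ind: y => y.
by rewrite quot_mulE !scaleqE quot_mulE scalerAr.
Qed.

Definition quot_alg : pzAlg k :=
  @PzAlg k Q quot_one quot_mul quot_mulA quot_mul1 quot_mulr1
    quot_mulDl quot_mulDr quot_scalerAl quot_scalerAr.

End PrincipalQuotient.

(* The difference is taken in \bar R: a zero quotient gives +oo. *)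
Definition pertinency (R : realType) (k : pzRingType) (gT : finGroupType)
    (A : algType k) (rho : algAction gT A) : \bar R :=
  (gkdim R A - gkdim R (quot_alg (skew_sum rho)))%E.

(* Main.v *)
(* Writing u f_G v = \sum_x a x(b) # x with a, b in A, the restriction of an
   element of (f_G) to the coordinates in H is \sum_(h in H) a h(b) # h, which
   lies in (f_H). Hence (f_G) meets the subalgebra A#H of A#G inside (f_H), so
   (A#H)/(f_H) is a quotient of a subalgebra of (A#G)/(f_G), and its
   Gelfand-Kirillov dimension is not larger. *)
From HB Require Import structures.
From mathcomp Require Import all_boot all_order all_algebra all_fingroup.
From mathcomp Require Import generic_quotient ring_quotient.
From mathcomp Require Import all_classical all_reals all_analysis.
Require Import Defs.

Set Implicit Arguments.
Unset Strict Implicit.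
Unset Printing Implicit Defensive.
Import Order.TTheory GRing.Theory Num.Theory.
Local Open Scope ring_scope.

Lemma le_limn_esup (R : realType) (u v : nat -> \bar R) :
  (forall n, u n <= v n)%E -> (limn_esup u <= limn_esup v)%E.
Proof.
move=> uv; rewrite !limn_esup_lim.
apply: lee_lim; [exact: is_cvg_esups | exact: is_cvg_esups |].
apply: nearW => n; apply: ge_ereal_sup => _ [m nm <-].
by apply: le_trans (uv m) _; apply: ereal_sup_ubound; exists m.
Qed.

(** The empty family already bounds the supremum below. This allows dimensions to be compared under
    [lne], which is monotone on nonnegative arguments. *)
Lemma ldim_ge0 (R : realType) (k : pzRingType) (V : lmodType k) (U : set V) :
  (0 <= ldim R U)%E.
Proof.
apply: ereal_sup_ubound; exists 0%N => //.
by exists (fun=> 0) => [[]|c _ []].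
Qed.

Section GkdimComparison.
Variables (R : realType) (k : pzRingType) (T : algType k) (B C : pzAlg k).
Variables (phi : {linear T -> B}) (psi : {linear T -> C}).
Hypothesis phi1 : phi 1 = pz_one B.
Hypothesis phiM : forall x y, phi (x * y) = pz_mul (phi x) (phi y).
Hypothesis psi1 : psi 1 = pz_one C.
Hypothesis psiM : forall x y, psi (x * y) = pz_mul (psi x) (psi y).
Hypothesis psi_surj : forall y, exists x, psi x = y.
Hypothesis ker_sub : forall x, phi x = 0 -> psi x = 0.

(** By [ker_sub], [psi] factors through the image of [phi]. The induced map is never built: elements
    of [C] are lifted to [T] and then pushed to [B]. Keeping the word length keeps the filtration
    degree. *)
Lemma word_prod_lift (s : seq T) (w : seq C) :
  words [set` map psi s] w ->
  exists2 t : T, psi t = word_prod w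
    & exists2 w' : seq B, words [set` map phi s] w' /\ size w' = size w
                        & phi t = word_prod w'.
Proof.
elim: w => [|y w IHw] ws /=.
  by exists 1; rewrite ?psi1 //; exists [::]; rewrite ?phi1.
have [|t <- [w' [ws' <-] tw']] := IHw.
  by move=> z zw; apply: ws; rewrite inE zw orbT.
have /mapP[x xs ->] := ws y (mem_head _ _).
exists (x * t); first by rewrite psiM.
exists (phi x :: w'); last by rewrite phiM tw'.
split=> // z; rewrite inE => /predU1P[->|/ws' //].
exact: map_f.
Qed.

Lemma gk_filtration_lift (s : seq T) (n : nat) (v : C) :
  gk_filtration (map psi s) n v ->
  exists2 t : T, psi t = v & gk_filtration (map phi s) n (phi t).
Proof.
case=> l; elim: l v => [|[c y] l IHl] v ls ->.
  exists 0; rewrite ?big_nil ?linear0 //.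
  by exists [::]; rewrite ?big_nil.
have [||t tv [l' ls' tl']] := IHl (\sum_(p <- l) p.1 *: p.2) => //.
  by move=> p pl; apply: ls; rewrite inE pl orbT.
have [w [ws wn] wy] := ls (c, y) (mem_head _ _).
have [x xw [w' [ws' sw'] xw']] := word_prod_lift ws.
exists (c *: x + t); first by rewrite linearP big_cons tv xw wy.
exists ((c, phi x) :: l'); last by rewrite linearP big_cons tl'.
move=> p; rewrite inE => /predU1P[->|/ls' //].
by exists w'; rewrite //= sw'.
Qed.

(** An independent family in [C] is lifted to [T] and pushed to [B]. A relation among the pushed
    vectors is an element of [T] killed by [phi], hence by [psi], so it holds for the original
    family. *)
Lemma ldim_gk_filtration_le (s : seq T) (n : nat) :
  (ldim R (gk_filtration (map psi s) n) <=
   ldim R (gk_filtration (map phi s) n))%E.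
Proof.
apply: ge_ereal_sup => _ [m [t tU tfree] <-].
apply: ereal_sup_ubound; exists m => //.
have /choice[t' t'P] i : exists x,
    psi x = t i /\ gk_filtration (map phi s) n (phi x).
  by have [x] := gk_filtration_lift (tU i); exists x.
exists (phi \o t') => [i|c c0]; first by have [] := t'P i.
apply: tfree; transitivity (psi (\sum_i c i *: t' i)).
  by rewrite linear_sum; apply: eq_bigr => i _; rewrite linearZ (t'P i).1.
apply: ker_sub; rewrite linear_sum -[RHS]c0.
by apply: eq_bigr => i _; rewrite linearZ.
Qed.

Lemma gkdim_le_of_ker_sub : (gkdim R C <= gkdim R B)%E.
Proof.
apply: ge_ereal_sup => _ [s _ <-].
have /choice[f fP] := psi_surj.
(* The list [map f s] in [T] links the two sides: its image under [phi] is the competitor in the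
   supremum for [B]. *)
have -> : s = map psi (map f s) by rewrite -map_comp (eq_map fP) map_id.
apply: le_trans; last first.
  by apply: ereal_sup_ubound; exists (map phi (map f s)).
apply: le_limn_esup => n; apply: lee_wpmul2r.
  (* The factor is nonnegative at [n = 0] too, because [ln 0 = 0]. *)
  by rewrite lee_fin invr_ge0; case: n => [|n]; [rewrite ln0 | rewrite ln_ge0 ?ler1n].
by rewrite lee_lne ?in_itv /= ?ldim_ge0 ?leey // ldim_gk_filtration_le.
Qed.

End GkdimComparison.

Section QuotientProjection.
Variables (k : pzRingType) (B : algType k) (f : B).
Local Open Scope quotient_scope.

Definition quot_pi (x : B) : quot_alg f := \pi_{ideal_quot (ideal_gen f)} x.

Fact quot_pi_linear : linear quot_pi.
Proof.
move=> c x y; rewrite /quot_pi raddfD; congr (_ + _).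
exact/esym/quot_scaleE.
Qed.

HB.instance Definition _ := GRing.isLinear.Build k B (quot_alg f) *:%R quot_pi
  quot_pi_linear.

Lemma quot_pi_eq0 x : (quot_pi x = 0) <-> (x \in ideal_gen f).
Proof.
rewrite -(linear0 quot_pi) -{2}[x]subr0.
by rewrite (Quotient.idealrBE (ideal_gen f)); split=> /eqP.
Qed.

Lemma quot_pi1 : quot_pi 1 = pz_one (quot_alg f).
Proof. reflexivity. Qed.

Lemma quot_piM x y : quot_pi (x * y) = pz_mul (quot_pi x) (quot_pi y).
Proof. exact/esym/quot_mulE. Qed.

Lemma quot_pi_surj y : exists x, quot_pi x = y.
Proof. by exists (repr y); apply: reprK. Qed.

End QuotientProjection.

Section SkewSum.
Variables (k : pzRingType) (gT : finGroupType) (A : algType k).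
Variable rho : algAction gT A.

(** Right multiplication by [skew_sum rho] makes every coefficient equal to [\sum_g u g]. The two
    sums do not depend on [x], so [x] enters only through [rho x]; this is what makes restriction to
    a subgroup possible. *)
Lemma skew_sum_sandwich (u v : skew rho) x :
  (u * skew_sum rho * v) x =
  (\sum_g u g) * rho x (\sum_g rho g^-1%g (v g)).
Proof.
have sumE y : skew_sum rho y = 1.
  rewrite /skew_sum sum_ffunE (bigD1 y) //= ffunE eqxx big1 ?addr0 // => g.
  by rewrite ffunE eq_sym => /negPf->.
have mul_sumE y : (u * skew_sum rho) y = \sum_g u g.
  by rewrite ffunE; apply: eq_bigr => g _; rewrite sumE rmorph1 mulr1.
rewrite ffunE raddf_sum [RHS]mulr_sumr.
(* Together the two reindexings replace [g] by [g^-1 * x], the argument of [v] in [skew_mul]. *)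
rewrite [RHS](reindex_inj invg_inj) /=.
rewrite [RHS](reindex_inj (mulgI x^-1%g)) /=; apply: eq_bigr => g _.
by rewrite mul_sumE -alg_actM invgK mulKVg invMg invgK.
Qed.

End SkewSum.

Section SkewRestriction.
Variables (k : pzRingType) (gT : finGroupType) (A : algType k).
Variables (rho : algAction gT A) (H : {group gT}).
Local Notation rhoH := (res_action rho H).

Definition skew_ext (u : skew rhoH) : skew rho :=
  [ffun g => if g \in H then u (subg H g) else 0].

Lemma skew_ext_sgval u (h : [subg H]) : skew_ext u (sgval h) = u h.
Proof. by rewrite ffunE subgP sgvalK. Qed.

Fact skew_ext_linear : linear skew_ext.
Proof.
move=> c u v; apply/ffunP => g; rewrite !ffunE.
by case: ifP => // _; rewrite scaler0 addr0.
Qed.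

HB.instance Definition _ :=
  GRing.isLinear.Build k (skew rhoH) (skew rho) *:%R skew_ext skew_ext_linear.

Lemma skew_ext1 : skew_ext 1 = 1.
Proof.
apply/ffunP => g; rewrite !ffunE; case: ifP => [gH|/negP gH].
  by rewrite -(inj_eq val_inj) /= subgK.
by case: eqP => // g1; case: gH; rewrite g1 group1.
Qed.

(** For [h] in [H], the element [h^-1 * g] lies in [H] exactly when [g] does, so the product of two
    elements supported on [H] is again supported on [H]. *)
Lemma skew_extM u v : skew_ext (u * v) = skew_ext u * skew_ext v.
Proof.
apply/ffunP => g; rewrite [RHS]ffunE (bigID (mem H)) /=.
rewrite addrC big1 ?add0r => [|h /negPf hH]; last by rewrite ffunE hH mul0r.
rewrite ffunE; case: ifP => [gH|/negbT gH]; last first.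
  rewrite big1 // => h hH; rewrite [X in rho h X]ffunE.
  by rewrite groupMl ?groupV // (negPf gH) raddf0 mulr0.
rewrite ffunE (reindex_onto sgval (subg H)) /= => [|h hH]; last exact: subgK.
apply: eq_big => [h|h _]; first by rewrite subgP sgvalK eqxx.
rewrite skew_ext_sgval; congr (_ * rho _ _).
by rewrite -skew_ext_sgval /= subgK.
Qed.

Lemma skew_ext_ideal u :
  skew_ext u \in ideal_gen (skew_sum rho) -> u \in ideal_gen (skew_sum rhoH).
Proof.
move=> /asboolP[s us]; apply/asboolP.
(* Each pair is [(a # 1, b # 1)], with [a] and [b] the two sums of [skew_sum_sandwich] over the
   whole group. The same lemma over [H] gives this product the coefficient [a * rho h b] at [h]. *)
exists [seq (skew_elt rhoH (\sum_g (p.1 : skew rho) g) 1%g,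
             skew_elt rhoH (\sum_g rho g^-1%g ((p.2 : skew rho) g)) 1%g) | p <- s].
apply/ffunP => h; rewrite -skew_ext_sgval us !sum_ffunE big_map.
apply: eq_bigr => p _; rewrite !skew_sum_sandwich /=.
(* Only the coefficient at [1] of [a # 1] survives, in the plain sum as well as in the one twisted
   by [rho g^-1]. *)
have sum1 (F : [subg H] -> A -> A) a : (forall g, F g 0 = 0) ->
    \sum_g F g (skew_elt rhoH a 1%g g) = F 1%g a.
  move=> F0; rewrite (bigD1 1%g) //= ffunE eqxx big1 ?addr0 // => g /negPf g1.
  by rewrite ffunE g1.
rewrite (sum1 (fun=> id)) // (sum1 (fun g => rho (sgval g^-1%g))) => [|g].
  by rewrite invg1 alg_act1.
exact: raddf0.
Qed.

Lemma gkdim_quot_skew_sum_res (R : realType) :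
  (gkdim R (quot_alg (skew_sum rhoH)) <= gkdim R (quot_alg (skew_sum rho)))%E.
Proof.
apply: (@gkdim_le_of_ker_sub R k (skew rhoH) _ _
  (@quot_pi _ _ (skew_sum rho) \o skew_ext) (@quot_pi _ _ (skew_sum rhoH))).
- by rewrite /= skew_ext1 quot_pi1.
- by move=> u v; rewrite /= skew_extM quot_piM.
- exact: quot_pi1.
- exact: quot_piM.
- exact: quot_pi_surj.
(* The kernel of the composite map is the part of [(f_G)] lying in [A#H], which [skew_ext_ideal]
   places in [(f_H)]. *)
- by move=> u /quot_pi_eq0/skew_ext_ideal/quot_pi_eq0.
Qed.

End SkewRestriction.

Theorem theorem4 (R : realType) (k : closedFieldType)
  (hchar : [pchar k] =i pred0)
  (A : algType k) (gr : nat -> set A)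
  (hgr : is_grading gr)
  (haff : affine A)
  (hgen1 : generates A (gr 1%N))
  (hfin : gkdim R A \is a fin_num)
  (G : finGroupType) (rho : algAction G A)
  (hrho : forall (g : G) (n : nat) (x : A), gr n x -> gr n (rho g x))
  (H : {group G}) :
  (pertinency R rho <= pertinency R (res_action rho H))%E.
Proof.
(* Both pertinencies start from [gkdim R A]; subtraction reverses the inequality between the
   quotients. *)
exact/leeB/gkdim_quot_skew_sum_res.
Qed.
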